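(* For every pair of positive integers $k,d$ with $k\leq d$ and $d\ge 2$, there exist a positive integer $c=c(d,k)$ and a real number $C=C(d,k)>0$ such that for every positive integer $n$ there exists a set $S\subset [n]^{d}$ with $|S|\geq Cn^{d(d-k)/(d-1)}$ such that no $k$-dimensional linear subspace of $\mathbb{R}^d$ contains more than $c$ elements of $S$.
   Context: $[n]^d=\{1,\dots,n\}^d\subset\mathbb{R}^d$ denotes the integer grid. *)

(* Defs.v *)
From HB Require Import structures.
From mathcomp Require Import all_boot all_order all_algebra finmap.
From mathcomp Require Import all_classical all_reals all_analysis.
Set Implicit Arguments.
Unset Strict Implicit.
Unset Printing Implicit Defensive.
Import Order.TTheory GRing.Theory Num.Theory.

Local Open Scope classical_set_scope.
Local Open Scope ring_scope.

Definition grid (R : realType) (n d : nat) : set 'rV[R]_d :=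
  [set x | forall i : 'I_d, exists2 m : nat, (1 <= m <= n)%N & x 0 i = m%:R].

(* Main.v *)
Require Import Defs.
From HB Require Import structures.
From mathcomp Require Import all_boot all_order all_algebra finmap.
From mathcomp Require Import all_classical all_reals all_analysis.
From mathcomp Require Import zify ring.
Set Implicit Arguments.
Unset Strict Implicit.
Unset Printing Implicit Defensive.
Import Order.TTheory GRing.Theory Num.Theory.

(** Choose a prime [p] of order [n^(d/(d-1))]. By pigeonhole every vector of
    [F_p^d] has a nonzero multiple that lifts to an integer vector with entries
    in [[-n, n]], so it is enough to find about [p^(d-k)] vectors of [F_p^d] of
    which boundedly many lie in each [k]-dimensional subspace: integer vectors of
    a [k]-dimensional real subspace span dimension at most [k] modulo [p]. Fixing
    the most popular sign pattern moves the lifts into the positive orthant.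

    Such vectors form a fibre of [x |-> (\sum_j a_j^i x_j^(d-j))_(i < k)] with
    distinct [a_j], some fibre being large by pigeonhole. On a subspace with
    pivot set [J] every other coordinate is a combination of earlier pivot
    coordinates, and Lagrange interpolation at the nodes [a_j] isolates
    [x_s^(d-s)], [s] in [J], modulo terms [x_j^(d-j)] with [j] outside [J]. If
    [x_j] has weight [d!/(d-j)], those terms have lower weight once the pivots
    are substituted. Hence monomials with bounded exponents span all functions on
    the fibre restricted to the subspace, which bounds its cardinality. *)

(** * Primes in geometric intervals *)

Definition primorial (n : nat) : nat := \prod_(0 <= p < n.+1 | prime p) p.

Lemma prime_dvdn_bin_mid n p : prime p -> n < p <= n.*2 -> p %| 'C(n.*2, n).
Proof.
move=> pp /andP[np p2n].
have : p %| 'C(n.*2, n) * (n`! * (n.*2 - n)`!).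
  by rewrite bin_fact ?dvdn_fact ?prime_gt0 //; lia.
have pn : coprime p n`!.
  elim: n np {p2n} => [|m IH] mp; first by rewrite coprimen1.
  rewrite factS coprimeMr IH 1?ltnW // andbT prime_coprime //.
  by apply/negP => /dvdn_leq; lia.
by rewrite (_ : n.*2 - n = n) ?Gauss_dvdl ?coprimeMr ?pn //; lia.
Qed.

Lemma prod_primes_dvdn (s : seq nat) m : uniq s ->
  {in s, forall p, prime p && (p %| m)} -> \prod_(p <- s) p %| m.
Proof.
elim: s => [|p s IH] /=; first by rewrite big_nil dvd1n.
move=> /andP[ps us] H; rewrite big_cons Gauss_dvd.
  have /andP[_ ->] := H p (mem_head _ _); apply: IH => // q qs.
  by apply: H; rewrite inE qs orbT.
have /andP[pp _] := H p (mem_head _ _).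
rewrite big_seq; elim/big_rec: _ => [|q x qs cx]; first by rewrite coprimen1.
rewrite coprimeMr cx andbT prime_coprime //.
have /andP[pq _] : prime q && (q %| m) by apply: H; rewrite inE qs orbT.
by rewrite dvdn_prime2 //; apply: contraNneq ps => ->.
Qed.

Lemma exp4_sum_bin n : 4 ^ n = \sum_(i < n.*2.+1) 'C(n.*2, i).
Proof.
rewrite -[4]/(2 ^ 2) -expnM mul2n -[2]/(1 + 1) expnDn.
by apply: eq_bigr => i _; rewrite !exp1n !muln1.
Qed.

Lemma bin_mid_le n : 'C(n.*2, n) <= 4 ^ n.
Proof.
rewrite exp4_sum_bin; have np : n < n.*2.+1 by lia.
by rewrite (bigD1 (Ordinal np)) //= leq_addr.
Qed.

(** The primes in [(n, 2n]] all divide ['C(2n, n)], which is at most [4 ^ n]. *)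
Lemma primorial_double n : primorial n.*2 <= primorial n * 4 ^ n.
Proof.
rewrite /primorial (big_cat_nat _ (n := n.+1)) //=; last lia.
rewrite leq_mul2l; apply/orP; right; apply: leq_trans (bin_mid_le n).
apply: dvdn_leq; first by rewrite bin_gt0; lia.
rewrite -big_filter; apply: prod_primes_dvdn; first by rewrite filter_uniq ?iota_uniq.
move=> p; rewrite mem_filter mem_index_iota => /andP[pp pn]; rewrite pp /=.
by apply: prime_dvdn_bin_mid => //; lia.
Qed.

Lemma primorial_exp2 m : primorial (2 ^ m) <= 4 ^ 2 ^ m.
Proof.
elim: m => [|m IH]; first by rewrite /primorial unlock.
rewrite expnS mul2n; apply: leq_trans (primorial_double _) _.
by rewrite -addnn expnD leq_mul2r IH orbT.
Qed.

(** The [2n + 1] binomials of row [2n] sum to [4 ^ n], and the middle one is the largest. *)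
Lemma bin_mid_ge n : 4 ^ n <= n.*2.+1 * 'C(n.*2, n).
Proof.
rewrite exp4_sum_bin -[X in _ <= X * _]card_ord -sum_nat_const; apply: leq_sum => i _.
have unimodal a : a <= n -> 'C(n.*2, a) <= 'C(n.*2, n).
  move=> an; rewrite -(subKn an); elim: (n - a) (leq_subr a n) => [|t IH] tn.
    by rewrite subn0.
  apply: leq_trans (IH (ltnW tn)).
  have := mul_bin_left n.*2 (n - t.+1).
  rewrite (_ : (n - t.+1).+1 = n - t); last lia.
  set x := 'C(_, n - t); set y := 'C(_, _) => E.
  have : (n - t) * y <= (n - t) * x by rewrite E; apply: leq_mul => //; lia.
  by rewrite leq_pmul2l; lia.
have [ni|ni] := leqP i n; first exact: unimodal.
by rewrite -bin_sub; last (have := ltn_ord i; lia); apply: unimodal; lia.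
Qed.

(** In Legendre's formula each [k] contributes at most one, because
    [2n %/ p ^ k <= 2 * (n %/ p ^ k) + 1], and only the [T] values of [k] with [p ^ k <= 2n]
    contribute. *)
Lemma pfactor_bin_mid_le n p : prime p -> 0 < n -> p ^ logn p 'C(n.*2, n) <= n.*2.
Proof.
move=> pp n0; have p1 := prime_gt1 pp.
apply: leq_trans (trunc_logP p1 _); last lia.
rewrite leq_exp2l //; set T := trunc_log _ _.
have TP : n.*2 < p ^ T.+1 by apply: trunc_log_ltn.
have E : logn p 'C(n.*2, n) + (logn p n`! + logn p n`!) = logn p (n.*2)`!.
  have nn : n.*2 - n = n by lia.
  rewrite -(@bin_fact n.*2 n) ?nn; last lia.
  by rewrite !lognM ?muln_gt0 ?fact_gt0 ?bin_gt0 //; lia.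
have F m : m <= n.*2 -> logn p m`! = \sum_(1 <= k < T.+1) m %/ p ^ k.
  move=> mn; rewrite logn_fact //.
  (* All terms past [minn m T] vanish, so the sums for the different factorials can share the range
     up to [T]. *)
  have S a b : (b = m \/ b = T) -> minn m T = a ->
      \sum_(1 <= k < b.+1) m %/ p ^ k = \sum_(1 <= k < a.+1) m %/ p ^ k.
    move=> bE aE; rewrite (big_cat_nat _ (n := a.+1)) //=; last by case: bE; lia.
    rewrite [X in _ + X]big1_seq ?addn0 // => k.
    rewrite mem_index_iota => /andP[_ /andP[ak kb]].
    apply: divn_small; have [mT|Tm] := leqP m T.
      case: bE => ?; first by lia.
      by apply: leq_trans (ltn_expl k p1); lia.
    by apply: leq_ltn_trans mn _; apply: (leq_trans TP); rewrite leq_exp2l; lia.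
  by rewrite (S _ _ (or_introl erefl) erefl) (S _ T (or_intror erefl) erefl).
have : logn p (n.*2)`! <= T + (logn p n`! + logn p n`!).
  rewrite !F; try lia.
  have TE : T = \sum_(1 <= k < T.+1) 1 by rewrite sum_nat_const_nat muln1 subn1.
  rewrite [X in _ <= X + _]TE -!big_split /=; apply: leq_sum => k _.
  have pk : 0 < p ^ k by rewrite expn_gt0 prime_gt0.
  rewrite -ltnS ltn_divLR // {1}(divn_eq n (p ^ k)).
  have := ltn_pmod n pk; set q := (n %/ _); set r := (n %% _) => rp.
  by rewrite mulSn !mulnDl mul1n; lia.
by rewrite -E; lia.
Qed.

(** A prime up to [h] contributes a prime power of size at most [2n]. A prime above [h] has
    [p ^ 2 > 2n], so it occurs at most once. *)
Lemma bin_mid_le_primorial n h : 0 < n -> n.*2 < h.+1 ^ 2 -> h <= n.*2 ->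
  'C(n.*2, n) <= n.*2 ^ h * primorial n.*2.
Proof.
move=> n0 nh hn; set B := 'C(_, _).
have B0 : 0 < B by rewrite bin_gt0; lia.
have logB p : prime p -> p ^ logn p B <= n.*2.
  by move=> pp; apply: pfactor_bin_mid_le.
have -> : B = \prod_(0 <= p < n.*2.+1 | prime p) p ^ logn p B.
  rewrite -[LHS](partnT B0) (@widen_partn (maxn B n.*2)) ?leq_maxl //.
  rewrite (big_cat_nat (n := n.*2.+1)) ?ltnS ?leq_maxr //= [X in _ * X]big_nat_cond.
  rewrite [X in _ * X]big1 ?muln1 => [|p /andP[/andP[np _] _]].
    rewrite [RHS]big_mkcond; apply: eq_bigr => p _.
    by case: ifP => // pp; rewrite lognE pp.
  have [pp|pp] := boolP (prime p); last by rewrite lognE (negPf pp).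
  have := logB p pp; case: logn => // l; rewrite expnS => H.
  have : p * 1 <= p * p ^ l by rewrite leq_mul2l expn_gt0 prime_gt0 // orbT.
  lia.
rewrite (big_cat_nat (n := h.+1)) //=; apply: leq_mul.
  rewrite big_mkcond big_ltn //= mul1n.
  rewrite -[X in _ <= _ ^ X](_ : h.+1 - 1 = h); last lia.
  rewrite -prod_nat_const_nat; apply: leq_prod => p _.
  by case: ifP => [/logB //|_]; lia.
rewrite /primorial [X in _ <= X](big_cat_nat (n := h.+1)) //=.
apply: leq_trans (leq_pmull _ _); last first.
  by apply: prodn_cond_gt0 => p; apply: prime_gt0.
rewrite big_nat_cond [X in _ <= X]big_nat_cond.
apply: leq_prod => p /andP[/andP[hp _] pp].
have := logB p pp; have p0 := prime_gt0 pp.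
case: (logn p B) => [|[|l]]; rewrite ?expn0 ?expn1 //.
rewrite !expnS => H.
have : h.+1 * h.+1 <= p * p by apply: leq_mul.
have : p * (p * 1) <= p * (p * p ^ l) by rewrite !leq_mul2l expn_gt0 prime_gt0 // !orbT.
move: nh; rewrite expnS expn1; lia.
Qed.

Lemma exp2_linear h : 5 <= h -> 2 * h * (2 ^ h + 1) < 2 ^ (2 * h).-1.
Proof.
move=> h5; have -> : h = (h - 5) + 5 by lia.
elim: (h - 5) => // t; rewrite addSn; set m := t + 5 => IH.
have -> : (2 * m.+1).-1 = (2 * m).-1.+2 by lia.
rewrite !expnS; have : 2 ^ 5 <= 2 ^ m by rewrite leq_exp2l // leq_addl.
rewrite (_ : 2 ^ 5 = 32) //; move: IH.
move: (2 ^ m) (2 ^ _) => x y.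
have : 5 <= m by rewrite leq_addl.
nia.
Qed.

(** Erdos's argument for Bertrand's postulate: without such a prime the primorials of [4 ^ h] and
    [4 ^ h.-1] agree, and the middle binomial with [2n = 4 ^ h] drops below its lower bound. *)
Lemma prime_between_exp4 h : 5 <= h -> exists2 p, prime p & 4 ^ h.-1 < p <= 4 ^ h.
Proof.
move=> h5.
pose P := [pred p | prime p && (4 ^ h.-1 < p)].
have [/hasP[p]|noP] := boolP (has P (index_iota 0 (4 ^ h).+1)).
  by rewrite mem_index_iota /= => pn /andP[pp ph]; exists p => //; rewrite ph; lia.
exfalso; have noprime p : prime p -> p <= 4 ^ h -> p <= 4 ^ h.-1.
  move=> pp ph; rewrite leqNgt; apply: contra noP => hp.
  by apply/hasP; exists p; rewrite ?mem_index_iota /= ?pp.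
pose n := 2 ^ (2 * h).-1.
have n2 : n.*2 = 4 ^ h.
  by rewrite /n -mul2n -expnS prednK ?expnM //; lia.
have n0 : 0 < n by rewrite expn_gt0.
have hh : 4 ^ h = (2 ^ h) ^ 2 by rewrite -expnM mulnC expnM.
have B1 : 'C(n.*2, n) <= n.*2 ^ (2 ^ h) * primorial n.*2.
  apply: bin_mid_le_primorial => //; rewrite n2 hh ?ltn_exp2r //.
  by rewrite expnS expn1 leq_pmulr // expn_gt0.
have B2 : primorial n.*2 <= 4 ^ 4 ^ h.-1.
  have -> : primorial n.*2 = primorial (4 ^ h.-1).
    rewrite /primorial (big_cat_nat (n := (4 ^ h.-1).+1)) //=; last first.
      by rewrite n2 ltnS leq_exp2l //; lia.
    rewrite [X in _ * X]big_nat_cond [X in _ * X]big_pred0 ?muln1 // => p.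
    by apply/negP => /andP[/andP[a b] pp]; have := noprime p pp; lia.
  by rewrite -[4]/(2 ^ 2) -expnM; apply: primorial_exp2.
have B3 := bin_mid_ge n.
have : 4 ^ n < 2 ^ (2 * h).+1 * (n.*2 ^ (2 ^ h) * 4 ^ 4 ^ h.-1).
  apply: leq_ltn_trans B3 _.
  apply: (@leq_ltn_trans (n.*2.+1 * (n.*2 ^ 2 ^ h * 4 ^ 4 ^ h.-1))).
    by rewrite leq_mul2l (leq_trans B1) ?orbT // leq_mul2l B2 orbT.
  rewrite ltn_mul2r muln_gt0 !expn_gt0 double_gt0 n0 /= expnS expnM n2.
  have : 0 < 4 ^ h.-1 by rewrite expn_gt0.
  by rewrite (_ : 4 ^ h = 4 * 4 ^ h.-1) -?expnS ?prednK //; lia.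
(* In powers of [2] the inequality reads [2n < 2h + 1 + 2h * 2 ^ h + n], against [exp2_linear]. *)
have -> : 4 ^ n = 2 ^ (4 ^ h) by rewrite -n2 -mul2n expnM.
have -> : n.*2 ^ (2 ^ h) = 2 ^ (2 * h * 2 ^ h) by rewrite n2 !expnM.
have -> : 4 ^ 4 ^ h.-1 = 2 ^ (2 * 4 ^ h.-1) by rewrite expnM.
rewrite -!expnD ltn_exp2l // -n2.
have -> : 2 * 4 ^ h.-1 = n.
  by rewrite /n -[4]/(2 ^ 2) -expnM -expnS; congr (_ ^ _); lia.
have := exp2_linear h5; rewrite -/n; lia.
Qed.

Lemma exists_prime_near : exists2 K, 0 < K &
  forall X, 2 <= X -> exists2 p, prime p & p <= X < K * p.
Proof.
(* From [4 ^ 5] on the factor [16] suffices; below it [p = 2] forces [512]. *)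
exists 512 => // X X2; have [XK|XK] := ltnP X 1024; first by exists 2 => //; lia.
pose h := trunc_log 4 X.
have /andP[h1 h2] : 4 ^ h <= X < 4 ^ h.+1 by apply: trunc_log_bounds; lia.
have h5 : 5 <= h by apply: trunc_log_max.
have [p pp /andP[p1 p2]] := prime_between_exp4 h5; exists p => //.
rewrite (leq_trans p2 h1) /=; apply: (leq_trans h2).
have -> : h.+1 = h.-1 + 2 by lia.
by rewrite expnD; lia.
Qed.

Local Open Scope ring_scope.

(** * Functions on a finite set of points of a vector space *)

Section ReducedMonomials.
Variables (F : finFieldType) (d : nat) (Z : {set 'rV[F]_d}).

Definition monomial (a : 'I_d -> nat) (x : 'rV[F]_d) : F :=
  \prod_s x 0 s ^+ a s.

(** Exponents stay below [d], so [d ^ d] coefficients describe [g] on [Z]; this count becomes the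
    final bound. *)
Definition reduced (g : 'rV[F]_d -> F) : Prop :=
  exists c : {ffun {ffun 'I_d -> 'I_d} -> F},
    {in Z, forall x, g x = \sum_b c b * monomial (fun s => b s) x}.

Lemma eq_reduced (g h : 'rV[F]_d -> F) :
  {in Z, g =1 h} -> reduced g -> reduced h.
Proof. by move=> gh [c cP]; exists c => x xZ; rewrite -gh // cP. Qed.

Lemma reduced0 : reduced (fun=> 0).
Proof.
by exists [ffun=> 0] => x _; rewrite big1 // => b _; rewrite ffunE mul0r.
Qed.

Lemma reducedD (g h : 'rV[F]_d -> F) :
  reduced g -> reduced h -> reduced (fun x => g x + h x).
Proof.
move=> [c cP] [c' c'P]; exists [ffun b => c b + c' b] => x xZ.
by rewrite cP // c'P // -big_split /=; apply: eq_bigr => b _; rewrite ffunE mulrDl.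
Qed.

Lemma reducedZ (k : F) (g : 'rV[F]_d -> F) :
  reduced g -> reduced (fun x => k * g x).
Proof.
move=> [c cP]; exists [ffun b => k * c b] => x xZ.
by rewrite cP // mulr_sumr; apply: eq_bigr => b _; rewrite ffunE mulrA.
Qed.

Lemma reduced_sum (I : Type) (r : seq I) (P : pred I) (g : I -> 'rV[F]_d -> F) :
  (forall i, P i -> reduced (g i)) -> reduced (fun x => \sum_(i <- r | P i) g i x).
Proof.
move=> gP; elim: r => [|i r IH].
  by apply: eq_reduced reduced0 => x _; rewrite big_nil.
case: (boolP (P i)) => Pi.
  by apply: eq_reduced (reducedD (gP i Pi) IH) => x _; rewrite big_cons Pi.
by apply: eq_reduced IH => x _; rewrite big_cons (negPf Pi).
Qed.

Lemma reduced_monomial_small (a : 'I_d -> nat) :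
  (forall s, (a s < d)%N) -> reduced (monomial a).
Proof.
move=> ad; pose b0 : {ffun 'I_d -> 'I_d} := [ffun s => Ordinal (ad s)].
exists [ffun b => (b == b0)%:R] => x _.
rewrite (bigD1 b0) //= big1 ?addr0 => [|b /negPf bb0].
  by rewrite ffunE eqxx mul1r; apply: eq_bigr => s _; rewrite ffunE.
by rewrite ffunE bb0 mul0r.
Qed.

Definition shift (a : 'I_d -> nat) (s : 'I_d) (t : nat) (i : 'I_d) : nat :=
  (a i + (i == s) * t)%N.

Lemma monomial_shift a s t x : monomial (shift a s t) x = monomial a x * x 0 s ^+ t.
Proof.
rewrite /monomial (bigD1 s) //= [in RHS](bigD1 s) //= /shift eqxx mul1n exprD.
rewrite -!mulrA; congr (_ * _); rewrite [RHS]mulrC; congr (_ * _).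
by apply: eq_bigr => i /negPf ->; rewrite mul0n addn0.
Qed.

Section Weights.
Variable w : 'I_d -> nat.

Definition weight (a : 'I_d -> nat) : nat := (\sum_s a s * w s)%N.

Lemma weight_shift a s t : weight (shift a s t) = (weight a + t * w s)%N.
Proof.
rewrite /weight (bigD1 s) //= [in RHS](bigD1 s) //= /shift eqxx mul1n mulnDl.
rewrite -!addnA; congr (_ + _)%N; rewrite [RHS]addnC; congr (_ + _)%N.
by apply: eq_bigr => i /negPf ->; rewrite mul0n addn0.
Qed.

(** In the application [e s = d - s] and [w s = d! / (d - s)]. All powers [x_s ^ e s] then have the
    same weight [L], while a nonpivot coordinate is a combination of lighter ones. *)
Variables (J : {set 'I_d}) (e : 'I_d -> nat) (L : nat).
Hypothesis e_gt0 : forall s, (0 < e s)%N.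
Hypothesis e_le : forall s, (e s <= d)%N.
Hypothesis w_gt0 : forall s, (0 < w s)%N.
Hypothesis w_mono : forall s j : 'I_d, (s < j)%N -> (w s < w j)%N.
Hypothesis eL : forall s, (e s * w s)%N = L.
Hypothesis nonpivot : forall j, j \notin J -> exists c : 'I_d -> F,
  {in Z, forall x : 'rV[F]_d, x 0 j = \sum_(s in J | (s < j)%N) c s * x 0 s}.
Hypothesis pivot : forall s, s \in J -> exists (b : F) (q : 'I_d -> F),
  {in Z, forall x : 'rV[F]_d, x 0 s ^+ e s = b + \sum_(j in ~: J) q j * x 0 j ^+ e j}.

(** Substituting earlier pivot coordinates for the [t] factors [x_j] lowers the weight by at least
    one per factor. *)
Lemma reduced_expand j a t : j \notin J ->
  (forall b, (weight b <= weight a + t * (w j).-1)%N -> reduced (monomial b)) ->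
  reduced (fun x => monomial a x * x 0 j ^+ t).
Proof.
move=> jJ; have [c cP] := nonpivot jJ.
elim: t a => [|t IH] a aP.
  have := aP a; rewrite mul0n addn0 => /(_ (leqnn _)).
  by apply: eq_reduced => x _; rewrite expr0 mulr1.
have H s : (s \in J) && (s < j)%N ->
    reduced (fun x => c s * (monomial (shift a s 1) x * x 0 j ^+ t)).
  move=> /andP[_ sj]; apply/reducedZ/IH => b bP; apply: aP; apply: (leq_trans bP).
  by rewrite weight_shift mul1n mulSn; have := w_mono sj; lia.
apply: eq_reduced (reduced_sum _ H) => x xZ.
rewrite exprS {2}(cP x xZ) mulr_suml mulr_sumr; apply: eq_bigr => s _.
by rewrite monomial_shift expr1; ring.
Qed.

Lemma weight_unshift a s t : (t <= a s)%N ->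
  exists2 a', weight a = (weight a' + t * w s)%N &
    monomial a =1 (fun x => monomial a' x * x 0 s ^+ t).
Proof.
move=> ta; pose a' i := (a i - (i == s) * t)%N.
have aE i : a i = shift a' s t i.
  by rewrite /shift /a'; case: eqP => [->|]; rewrite ?mul1n ?mul0n; lia.
exists a'; first by rewrite -weight_shift; apply: eq_bigr => i _; rewrite aE.
by move=> x; rewrite -monomial_shift; apply: eq_bigr => i _; rewrite aE.
Qed.

(** Strong induction on the weight. Suppose some exponent is at least [d]. A nonpivot coordinate is
    expanded in lighter pivots. For a pivot, [x_s ^ e s] is traded for a constant and nonpivot
    powers of equal weight [L], which become lighter once expanded. *)
Lemma reduced_monomial a : reduced (monomial a).
Proof.
have [m] := ubnP (weight a); elim: m a => // m IH a; rewrite ltnS => am.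
have [/forallP ad|] := boolP [forall s, a s < d]%N.
  exact: reduced_monomial_small.
rewrite negb_forall => /existsP[s]; rewrite -leqNgt => das.
have d0 : (0 < d)%N by case: (s) => /= ? ; lia.
have [sJ|sJ] := boolP (s \in J); last first.
  have [a' wa' aE] := @weight_unshift a s (a s) (leqnn _).
  apply: (@eq_reduced (fun x => monomial a' x * x 0 s ^+ a s)) => [x _|].
    by rewrite aE.
  apply: reduced_expand => // b bP; apply: IH; apply: (leq_ltn_trans bP).
  apply: leq_trans am; rewrite wa' ltn_add2l ltn_pmul2l; last lia.
  by have := w_gt0 s; lia.
have es := leq_trans (e_le s) das.
have [a' wa' aE] := @weight_unshift a s (e s) es.
have [b [q qP]] := pivot sJ.
have L0 : (0 < L)%N by rewrite -(eL s) muln_gt0 e_gt0 w_gt0.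
have red1 : reduced (fun x => b * monomial a' x).
  by apply/reducedZ/IH; apply: leq_trans am; rewrite wa' eL -addn1 leq_add2l.
have red2 j : j \in ~: J -> reduced (fun x => q j * (monomial a' x * x 0 j ^+ e j)).
  rewrite inE => jJ; apply/reducedZ/reduced_expand => // b' b'P.
  apply: IH; apply: (leq_ltn_trans b'P); apply: leq_trans am.
  rewrite wa' ltn_add2l eL -(eL j) ltn_pmul2l //.
  by have := w_gt0 j; lia.
apply: eq_reduced (reducedD red1 (reduced_sum _ red2)) => x xZ.
rewrite aE qP // mulrDr mulrC; congr (_ + _).
by rewrite mulr_sumr; apply: eq_bigr => j _; ring.
Qed.

Lemma reduced_mulX s c g : reduced g -> reduced (fun x => (x 0 s - c) * g x).
Proof.
move=> rg; case: (rg) => k kP.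
have H b : true -> reduced (fun x => k b * monomial (shift (fun i => b i) s 1) x).
  by move=> _; apply/reducedZ/reduced_monomial.
apply: eq_reduced (reducedD (reduced_sum _ H) (reducedZ (- c) rg)) => x xZ.
rewrite mulrDl; congr (_ + _).
rewrite kP // mulr_sumr; apply: eq_bigr => b _.
by rewrite monomial_shift expr1; ring.
Qed.

Lemma reduced_all g : reduced g.
Proof.
(* [D z] is nonzero at [z] and zero at every other point, so every function is a combination of the
   [D z]. *)
pose D (z x : 'rV[F]_d) : F :=
  \prod_(sc : 'I_d * F | sc.2 != z 0 sc.1) (x 0 sc.1 - sc.2).
have redD z : reduced (D z).
  rewrite /D; elim: (index_enum _) => [|i r IH].
    apply: eq_reduced (reduced_monomial (fun=> 0%N)) => x _.
    by rewrite big_nil /monomial big1.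
  case: (boolP (i.2 != z 0 i.1)) => iz.
    by apply: eq_reduced (reduced_mulX i.1 i.2 IH) => x _; rewrite big_cons iz.
  by apply: eq_reduced IH => x _; rewrite big_cons (negPf iz).
have Dzz z : D z z != 0.
  by apply/prodf_neq0 => -[s c] /= cz; rewrite subr_eq0 eq_sym.
have Dzx z x : x != z -> D z x = 0.
  move=> xz; have [s sP] : exists s, x 0 s != z 0 s.
    apply/existsP; apply: contraNT xz; rewrite negb_exists => /forallP h.
    by apply/eqP/rowP => s; apply/eqP; have := h s; rewrite negbK.
  by apply/eqP/prodf_eq0; exists (s, x 0 s) => //=; rewrite subrr.
have H z : true -> reduced (fun x => (g z / D z z) * D z x).
  by move=> _; apply: reducedZ.
apply: eq_reduced (reduced_sum (index_enum 'rV[F]_d) H) => x _.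
rewrite (bigD1 x) //= big1 => [|z zx]; first by rewrite addr0 divfK.
by rewrite (Dzx z x) ?mulr0 // eq_sym.
Qed.

(** Evaluation maps the coefficient families onto all functions on [Z], so
    [#|F| ^ #|Z| <= #|F| ^ (d ^ d)]. *)
Lemma card_le_monomials : (#|Z| <= d ^ d)%N.
Proof.
pose ev (c : {ffun {ffun 'I_d -> 'I_d} -> F}) : {ffun {x | x \in Z} -> F} :=
  [ffun x => \sum_b c b * monomial (fun s => b s) (val x)].
have evP h : h \in codom ev.
  pose g x : F := if insub x is Some y then h y else 0.
  have [c cP] := reduced_all g.
  apply/codomP; exists c; apply/ffunP => x; rewrite ffunE -cP ?(valP x) //.
  by rewrite /g valK.
have : (#|{ffun {x | x \in Z} -> F}| <= #|{ffun {ffun 'I_d -> 'I_d} -> F}|)%N.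
  apply: leq_trans (leq_image_card ev predT).
  by apply/subset_leq_card/fintype.subsetP => h _; apply: evP.
rewrite !card_ffun !card_ord card_sig.
by rewrite leq_exp2l ?card_finNzRing_gt1.
Qed.

End Weights.
End ReducedMonomials.

Lemma evasive_card (F : finFieldType) (d : nat) (Z : {set 'rV[F]_d}) (J : {set 'I_d}) :
  (forall j, j \notin J -> exists c : 'I_d -> F,
     {in Z, forall x : 'rV[F]_d, x 0 j = \sum_(s in J | (s < j)%N) c s * x 0 s}) ->
  (forall s, s \in J -> exists (b : F) (q : 'I_d -> F),
     {in Z, forall x : 'rV[F]_d,
       x 0 s ^+ (d - s) = b + \sum_(j in ~: J) q j * x 0 j ^+ (d - j)}) ->
  (#|Z| <= d ^ d)%N.
Proof.
have dvd (s : 'I_d) : (d - s %| d`!)%N by apply: dvdn_fact; have := ltn_ord s; lia.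
have eL (s : 'I_d) : ((d - s) * (d`! %/ (d - s)))%N = d`!.
  by rewrite mulnC divnK.
apply: (@card_le_monomials _ _ _ (fun s => d`! %/ (d - s))%N _ _ d`!) => //.
- by move=> s; rewrite subn_gt0.
- by move=> s; rewrite leq_subr.
- by move=> s; have := eL s; case: (_ %/ _)%N => //; have := fact_gt0 d; lia.
(* The product of [d - s] and its weight is always [d!], so a smaller first factor forces a larger
   weight. *)
- move=> s j sj; rewrite ltnNge; apply/negP => ws_ge.
  have := leq_mul (leqnn (d - j)) ws_ge.
  rewrite !eL leqNgt => /negP; apply.
  rewrite -{2}(eL s) ltn_mul2r; have := ltn_ord j; have := eL s; have := fact_gt0 d.
  by case: (_ %/ _)%N => //=; lia.
Qed.

(** * Fibres of power maps on subspaces *)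

Section Pivots.
Variables (F : fieldType) (m d : nat) (N : 'M[F]_(d, m)).

Definition prefix_space (t : nat) : 'M[F]_m :=
  (\sum_(s : 'I_d | (s < t)%N) <<row s N>>)%MS.

(** The greedy basis of the row space. It is applied to the transposed matrix of points, whose rows
    are the coordinate functions. *)
Definition pivots : {set 'I_d} :=
  [set j : 'I_d | ~~ (row j N <= prefix_space j)%MS].

(** A nonpivot row is spanned by earlier rows, hence inductively by earlier pivot rows. *)
Lemma prefix_space_pivots t :
  (prefix_space t <= \sum_(s in pivots | (s < t)%N) <<row s N>>)%MS.
Proof.
elim/ltn_ind: t => t IH; apply/sumsmx_subP => s st; rewrite genmxE.
have [sJ|] := boolP (s \in pivots).
  by apply: (sumsmx_sup s); rewrite ?sJ ?genmxE.
rewrite inE negbK => /submx_trans; apply; apply: submx_trans (IH s st) _.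
apply/sumsmx_subP => i /andP[iJ is_]; apply: (sumsmx_sup i) => //.
by rewrite iJ (ltn_trans is_).
Qed.

Lemma nonpivot_row j : j \notin pivots -> exists c : 'I_d -> F,
  row j N = \sum_(s in pivots | (s < j)%N) c s *: row s N.
Proof.
rewrite inE negbK => jP.
have /sub_sumsmxP[u uE] := submx_trans jP (prefix_space_pivots j).
have H s : exists c, u s *m <<row s N>>%MS == c *: row s N.
  have /sub_rVP[c cE] : (u s *m <<row s N>> <= row s N)%MS.
    by apply: submx_trans (submxMl _ _) _; rewrite genmxE.
  by exists c; apply/eqP.
exists (fun s => xchoose (H s)); rewrite {1}uE; apply: eq_bigr => s _.
exact/eqP/(xchooseP (H s)).
Qed.

Lemma card_pivots : (#|pivots| <= \rank N)%N.
Proof.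
have H t : (t <= d)%N ->
    (#|[set s in pivots | (s < t)%N]| <= \rank (prefix_space t))%N.
  elim: t => [|t IH] td.
    rewrite (_ : [set _ in _ | _] = finset.set0) ?cards0 //.
    by apply/setP => s; rewrite !inE andbF.
  pose T := Ordinal td.
  have NE : (prefix_space t.+1 :=: <<row T N>> + prefix_space t)%MS.
    rewrite /prefix_space (bigD1 T) //=; apply: adds_eqmx => //.
    rewrite (eq_bigl (fun s : 'I_d => (s < t)%N)) // => s.
    by rewrite ltnS -val_eqE /= [RHS]ltn_neqAle andbC.
  have NS : (prefix_space t <= prefix_space t.+1)%MS by rewrite NE addsmxSr.
  have [TJ|TJ] := boolP (T \in pivots); last first.
    apply: leq_trans (mxrankS NS); apply: leq_trans (IH (ltnW td)).
    apply: subset_leq_card; apply/fintype.subsetP => s; rewrite !inE => /andP[sJ].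
    rewrite sJ /= ltnS leq_eqVlt => /orP[/eqP st|//].
    by move: TJ; rewrite (_ : T = s) ?inE ?sJ //; apply: val_inj.
  have : (\rank (prefix_space t) < \rank (prefix_space t.+1))%N.
    apply: rank_ltmx; rewrite ltmxE NS NE /=.
    move: TJ; rewrite inE; apply: contra; apply: submx_trans.
    by apply: submx_trans (addsmxSl _ _); rewrite genmxE.
  apply: leq_trans; apply: leq_trans (leq_add (leqnn 1) (IH (ltnW td))).
  rewrite -[1%N](cards1 T); apply: leq_trans (leq_card_setU _ _).
  apply: subset_leq_card; apply/fintype.subsetP => s; rewrite !inE ltnS leq_eqVlt.
  by rewrite -val_eqE /= andb_orr => /orP[/andP[_ ->]|->] //; rewrite orbT.
apply: leq_trans (leq_trans (H d (leqnn _)) _).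
  by apply: subset_leq_card; apply/fintype.subsetP => s; rewrite !inE ltn_ord andbT.
by apply/mxrankS/sumsmx_subP => s _; rewrite genmxE row_sub.
Qed.

End Pivots.

(** At most [k] coordinates are pivots, so a polynomial vanishing at the nodes of all pivots but one
    can have degree below [k], and its coefficients combine the [k] fibre equations. *)
Lemma evasive_fibre (F : finFieldType) (d k : nat) (a : 'I_d -> F)
    (Z : {set 'rV[F]_d}) (b : 'I_k -> F) : injective a ->
  {in Z, forall (x : 'rV[F]_d) (i : 'I_k),
    \sum_j a j ^+ i * x 0 j ^+ (d - j) = b i} ->
  (\rank (\matrix_(i < #|Z|) enum_val i) <= k)%N ->
  (#|Z| <= d ^ d)%N.
Proof.
move=> a_inj fib rk; set M := (\matrix_(i < #|Z|) enum_val i) in rk.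
pose J := pivots M^T.
have Jk : (#|J| <= k)%N by apply: leq_trans (card_pivots _) _; rewrite mxrank_tr.
apply: (@evasive_card F d Z J) => [j jJ|s sJ].
  have [c cE] := nonpivot_row jJ; exists c => x xZ.
  have := congr1 (fun r : 'rV_ _ => r 0 (enum_rank_in xZ x)) cE.
  have rE i : row i M^T 0 (enum_rank_in xZ x) = x 0 i.
    by rewrite !mxE enum_rankK_in.
  by rewrite rE summxE => ->; apply: eq_bigr => i _; rewrite mxE rE.
pose Q := \prod_(j in J :\ s) ('X - (a j)%:P).
have Qs : Q.[a s] != 0.
  rewrite horner_prod; apply/prodf_neq0 => j; rewrite !inE => /andP[js _].
  by rewrite hornerXsubC subr_eq0 eq_sym (inj_eq a_inj).
have Q0 j : j \in J -> j != s -> Q.[a j] = 0.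
  move=> jJ js; rewrite horner_prod; apply/eqP/prodf_eq0; exists j.
    by rewrite in_setD1 js.
  by rewrite hornerXsubC subrr.
have Qk : (size Q <= k)%N.
  rewrite /Q -big_enum size_prod_XsubC -cardE; apply: leq_trans Jk.
  by rewrite (cardsD1 s J) sJ.
(* The combined equation has the coefficient [Q(a_j)] at [x_j ^ (d - j)]. Pivots other than [s] drop
   out, and it is solved for [x_s ^ (d - s)]. *)
exists ((\sum_(i < k) Q`_i * b i) / Q.[a s]), (fun j => - (Q.[a j] / Q.[a s])) => x xZ.
have : \sum_(i < k) Q`_i * b i = \sum_j Q.[a j] * x 0 j ^+ (d - j).
  transitivity (\sum_(i < k) \sum_j Q`_i * a j ^+ i * x 0 j ^+ (d - j)).
    apply: eq_bigr => i _; rewrite -(fib x xZ) mulr_sumr.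
    by apply: eq_bigr => j _; rewrite mulrA.
  rewrite exchange_big; apply: eq_bigr => j _.
  by rewrite (horner_coef_wide _ Qk) mulr_suml.
move=> ->; rewrite (bigID (mem J)) /= (bigD1 s) //= big1 ?addr0; last first.
  by move=> j /andP[jJ js]; rewrite Q0 ?mul0r.
rewrite (mulrC Q.[a s]) mulrDl mulfK // mulr_suml -addrA.
rewrite [X in _ + (X + _)](eq_bigl (fun j => j \in ~: J)) => [|j].
  2: by rewrite finset.in_setC.
rewrite -big_split /= big1 ?addr0 // => j _; ring.
Qed.

(** * Lifting to the integer grid *)

(** Dirichlet's argument: cutting the residues into blocks of length [n] gives fewer than [p] boxes,
    so two multipliers send [x] to the same box, and their difference is the required [l]. *)
Lemma small_multiple (p n d : nat) (x : 'rV['F_p]_d) : prime p ->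
  (0 < n)%N -> ((p %/ n).+1 ^ d < p)%N ->
  exists l : 'F_p, exists (e : {ffun 'I_d -> bool}) (v : {ffun 'I_d -> 'I_n.+1}),
    l != 0 /\ forall i, l * x 0 i = (-1) ^+ e i * (v i : nat)%:R.
Proof.
move=> pp n0 hp.
pose f (l : 'F_p) : {ffun 'I_d -> 'I_(p %/ n).+1} :=
  [ffun i => inord ((l * x 0 i : 'F_p)%R %/ n)].
have fE l i : f l i = ((l * x 0 i : 'F_p)%R %/ n)%N :> nat.
  rewrite ffunE inordK // ltnS leq_div2r //.
  by rewrite -[X in (_ <= X)%N](Fp_cast pp) ltnW.
have [/injectiveP/leq_card|/injectivePn[l1 [l2 l12 fl]]] := boolP (injectiveb f).
  by rewrite card_Fp // card_ffun !card_ord leqNgt hp.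
pose y1 i : nat := (l1 * x 0 i : 'F_p); pose y2 i : nat := (l2 * x 0 i : 'F_p).
have y12 i : (y1 i %/ n = y2 i %/ n)%N by rewrite -!fE fl.
(* With truncated subtraction the sum is [|y1 - y2|], at most [n] since both lie in one block; the
   bit records the sign. *)
exists (l1 - l2), [ffun i => (y1 i < y2 i)%N],
  [ffun i => inord ((y1 i - y2 i) + (y2 i - y1 i))].
split=> [|i]; first by rewrite subr_eq0.
rewrite !ffunE inordK; last first.
  have := y12 i; have := ltn_pmod (y1 i) n0; have := ltn_pmod (y2 i) n0.
  have := divn_eq (y1 i) n; have := divn_eq (y2 i) n => E2 E1 + + H.
  by rewrite -H in E2; lia.
rewrite mulrBl -[l1 * _]natr_Zp -[l2 * _]natr_Zp -/(y1 i) -/(y2 i).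
have [lt12|le21] := ltnP (y1 i) (y2 i).
  rewrite (_ : (y1 i - y2 i) = 0)%N ?add0n ?natrB; [|exact: ltnW|lia].
  by rewrite expr1; ring.
by rewrite (_ : (y2 i - y1 i) = 0)%N ?addn0 ?natrB ?expr0 ?mul1r //; lia.
Qed.

(** * Rank bounds through minors *)

Lemma rank_le_minors (F : fieldType) (m n k : nat) (M : 'M[F]_(m, n)) :
  (forall r (f : 'I_r -> 'I_m) (g : 'I_r -> 'I_n), (k < r)%N ->
     \det (mxsub f g M) = 0) -> (\rank M <= k)%N.
Proof.
move=> H; rewrite leqNgt; apply/negP => kr.
pose A := rowsub (maxrankfun M) M.
have fA : row_full A^T by rewrite /row_full mxrank_tr; exact: (maxrowsub_free M).
have := fullrowsub_unit fA; rewrite unitmxE unitfE => /negP; apply.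
rewrite -det_tr (_ : _^T = mxsub (maxrankfun M) (fullrankfun fA) M) ?H //.
by apply/matrixP => i j; rewrite !mxE.
Qed.

(** A nonzero minor would make the [r] vectors [f i] of [U] linearly independent. *)
Lemma minors_subspace (F : fieldType) (d : nat) (U : {vspace 'rV[F]_d}) (r : nat)
    (f : 'I_r -> 'rV[F]_d) (g : 'I_r -> 'I_d) :
  (forall i, f i \in U) -> (\dim U < r)%N -> \det (\matrix_(i, j) f i 0 (g j)) = 0.
Proof.
move=> fU Ur; apply/eqP; rewrite -[_ == 0]negbK -unitfE -unitmxE.
set W := (\matrix_(i, j) _); apply/negP => Wu.
have fr : free [tuple f i | i < r].
  apply/freeP => c c0 i.
  have : (\row_i c i) *m W = 0.
    apply/rowP => j; rewrite !mxE.
    transitivity ((\sum_i c i *: [tuple f i | i < r]`_i) 0 (g j)).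
      rewrite summxE; apply: eq_bigr => l _; rewrite !mxE.
      by rewrite -tnth_nth tnth_mktuple.
    by rewrite c0 mxE.
  move=> /(congr1 (fun B => B *m invmx W)); rewrite mulmxK // mul0mx.
  by move=> /rowP/(_ i); rewrite !mxE.
have := dimvS (_ : (<<[tuple f i | i < r]>> <= U)%VS).
move: fr; rewrite /free size_tuple => /eqP -> H.
have : (r <= \dim U)%N.
  by apply: H; apply/span_subvP => x /mapP[i _ ->]; apply: fU.
lia.
Qed.

Lemma pigeonhole_fibre (A T : finType) (X : {set A}) (f : A -> T) : (0 < #|T|)%N ->
  exists t, (#|X| <= #|[set x in X | f x == t]| * #|T|)%N.
Proof.
move=> T0; pose F t := #|[set x in X | f x == t]|.
have [t tE] := bigop.eq_bigmax F T0; exists t.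
rewrite -/(F t) -tE mulnC -sum_nat_const.
have -> : #|X| = (\sum_t F t)%N.
  rewrite -sum1_card (partition_big f predT) //=; apply: eq_bigr => s _.
  by rewrite /F -sum1_card; apply: eq_bigl => x; rewrite !inE.
by apply: leq_sum => s _; apply: bigop.leq_bigmax.
Qed.

(* "Rank at most [k]" over the integers, in the form that transfers both from
   the reals and to ['F_p]. *)
Definition vanishing_minors (d n k : nat) (V : {set {ffun 'I_d -> 'I_n.+1}}) : Prop :=
  forall r (f : 'I_r -> {ffun 'I_d -> 'I_n.+1}) (g : 'I_r -> 'I_d),
    (forall i, f i \in V) -> (k < r)%N ->
    \det (\matrix_(i, j) (f i (g j) : nat)%:Z) = 0.

(** Such minors have two equal rows. The singleton case serves to bound how many points share one
    lift. *)
Lemma vanishing_minors1 (d n k : nat) (v : {ffun 'I_d -> 'I_n.+1}) :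
  (0 < k)%N -> vanishing_minors k [set v]%SET.
Proof.
move=> k0 [|[|r]] f g fv; [by []|lia|] => _.
apply: (@determinant_alternate _ _ _ 0 1) => // j; rewrite !mxE.
by move: (fv 0) (fv 1); rewrite !inE => /eqP-> /eqP->.
Qed.

(** [V] consists of the lifts of a large class of vectors with common fibre value and sign pattern.
    There are [p ^ k * 2 ^ d] classes, and at most [d ^ d] vectors of the chosen class share a
    lift. *)
Lemma evasive_box (p n d k : nat) : prime p -> (0 < k)%N ->
  (d <= p)%N -> (0 < n)%N -> ((p %/ n).+1 ^ d < p)%N ->
  exists V : {set {ffun 'I_d -> 'I_n.+1}},
    [/\ forall v i, v \in V -> (0 < v i)%N,
        ((p - 1) ^ d <= #|V| * d ^ d * (p ^ k * 2 ^ d))%N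
      & forall V' : {set {ffun 'I_d -> 'I_n.+1}}, V' \subset V ->
          vanishing_minors k V' -> (#|V'| <= d ^ d)%N].
Proof.
move=> pp k0 dp n0 hp.
have /choice[l /choice[sg /choice[v lsv]]] :=
  fun x : 'rV['F_p]_d => small_multiple x pp n0 hp.
have l0 x : l x != 0 by case: (lsv x).
have lE x i : l x * x 0 i = (-1) ^+ sg x i * (v x i : nat)%:R by case: (lsv x).
pose a (j : 'I_d) : 'F_p := (j : nat)%:R.
have a_inj : injective a.
  move=> i j /(congr1 (fun y : 'F_p => y : nat)); rewrite !val_Fp_nat //.
  have := ltn_ord i; have := ltn_ord j => jd id.
  by rewrite !modn_small ?(leq_trans _ dp) // => /val_inj.
(* Nonzero coordinates guarantee lifts with positive entries. *)
pose X : {set 'rV['F_p]_d} := [set x : 'rV['F_p]_d | [forall i, x 0 i != 0]]%SET.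
have cardX : #|X| = ((p - 1) ^ d)%N.
  pose row_of (f : {ffun 'I_d -> 'F_p}) : 'rV['F_p]_d := \row_i f i.
  have row_inj : injective row_of.
    by move=> f g /rowP fg; apply/ffunP => i; have := fg i; rewrite !mxE.
  have -> : X = row_of @: ffun_on (predC1 (0 : 'F_p)).
    apply/setP => x; rewrite inE; apply/forallP/imsetP => [x0|[f /ffun_onP f0 ->] i].
      exists [ffun i => x 0 i]; first by apply/ffun_onP => i; rewrite ffunE; apply: x0.
      by apply/rowP => i; rewrite mxE ffunE.
    by rewrite mxE; apply: f0.
  by rewrite card_imset // card_ffun_on cardC1 card_Fp // card_ord subn1.
pose phi (x : 'rV['F_p]_d) : {ffun 'I_k -> 'F_p} :=
  [ffun i : 'I_k => \sum_j a j ^+ i * x 0 j ^+ (d - j)].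
have cardT : #|{: {ffun 'I_k -> 'F_p} * {ffun 'I_d -> bool}}| = (p ^ k * 2 ^ d)%N.
  by rewrite card_prod !card_ffun card_Fp // !card_ord card_bool.
have [|[b e]] := @pigeonhole_fibre _ _ X (fun x => (phi x, sg x)).
  by rewrite cardT muln_gt0 !expn_gt0 prime_gt0.
rewrite cardT => bE.
set Y := [set x in X | _]%SET in bE.
have main (V' : {set {ffun 'I_d -> 'I_n.+1}}) : vanishing_minors k V' ->
    (#|[set x in Y | v x \in V']| <= d ^ d)%N.
  move=> mV'; set Z := [set x in Y | _]%SET.
  have ZP x : x \in Z -> [/\ phi x = b, sg x = e & v x \in V'].
    by rewrite !inE => /andP[/andP[_ /eqP[-> ->]] ->].
  apply: (@evasive_fibre _ d k a Z b) => // [x /ZP[<- _ _] i|]; first by rewrite ffunE.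
  apply: rank_le_minors => r f g kr; pose z i := enum_val (f i).
  have := mV' r (fun i => v (z i)) g.
  have zZ i : z i \in Z by apply: enum_valP.
  move=> /(_ (fun i => let: And3 _ _ h := ZP _ (zZ i) in h) kr).
  move=> /(congr1 (fun y : int => y%:~R : 'F_p)); rewrite -det_map_mx.
  (* With a common sign pattern, passing from points to lifts only scales rows by multipliers and
     columns by signs, all nonzero, so the minors vanish together. *)
  have -> : map_mx intr (\matrix_(i, j) (v (z i) (g j) : nat)%:Z) =
    diag_mx (\row_i l (z i)) *m mxsub f g (\matrix_i enum_val i)
      *m diag_mx (\row_j (-1) ^+ e (g j)) :> 'M['F_p]_r.
    apply/matrixP => i j; rewrite mul_mx_diag mul_diag_mx !mxE -/(z i) lE.
    have [_ -> _] := ZP _ (zZ i).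
    by rewrite mulrAC -expr2 sqrr_sign mul1r.
  rewrite !det_mulmx !det_diag => /eqP; rewrite !mulf_eq0 => /orP[/orP[]|].
  - by move=> /prodf_eq0[i _]; rewrite mxE (negPf (l0 _)).
  - by move=> /eqP.
  - by move=> /prodf_eq0[i _]; rewrite mxE signr_eq0.
exists (v @: Y); split.
- move=> _ i /imsetP[x xY ->]; rewrite lt0n; apply/eqP => vi0.
  have := lE x i; rewrite vi0 mulr0 => /eqP; rewrite mulf_eq0 (negPf (l0 x)) /=.
  by move: xY; rewrite !inE => /andP[/forallP/(_ i)/negPf->].
- rewrite -cardX; apply: (leq_trans bE).
  rewrite leq_mul2r; apply/orP; right.
  rewrite -[X in (X <= _)%N]sum1_card (partition_big v (mem (v @: Y))) /=; last first.
    by move=> x xY; apply: imset_f.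
  rewrite -sum_nat_const; apply: leq_sum => w _.
  apply: leq_trans (main [set w]%SET (@vanishing_minors1 _ _ _ w k0)).
  by rewrite -sum1_card; apply/eq_leq/eq_bigl => x; rewrite !inE.
- move=> V' sV' mV'; apply: leq_trans (main _ mV').
  apply: leq_trans (leq_imset_card v _).
  apply/subset_leq_card/fintype.subsetP => w wV'.
  have /imsetP[x xY wE] := fintype.subsetP sV' _ wV'.
  by apply/imsetP; exists x => //; rewrite inE xY -wE.
Qed.

(** * Choice of the prime and size of the set *)

Lemma leq_expl (m1 m2 e : nat) : (m1 <= m2)%N -> (m1 ^ e <= m2 ^ e)%N.
Proof. by case: e => // e; rewrite leq_exp2r. Qed.

(** For [n <= p] one has [(p %/ n).+1 * n <= 2 * p]; the [d]-th power of this is compared with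
    [p * n ^ d]. *)
Lemma divn_exp_ltn (p n d : nat) : (1 < p)%N -> (0 < n)%N -> (0 < d)%N ->
  (2 ^ d * p ^ (d - 1) < n ^ d)%N -> ((p %/ n).+1 ^ d < p)%N.
Proof.
move=> p1 n0 d0 pnd; have [pn|np] := ltnP p n; first by rewrite divn_small // exp1n.
have nd0 : (0 < n ^ d)%N by rewrite expn_gt0 n0.
rewrite -(ltn_pmul2r nd0) -expnMn mulnC.
apply: (@leq_ltn_trans ((2 * p) ^ d)).
  apply: leq_expl; rewrite mulnS mul2n -addnn leq_add // mulnC.
  exact: leq_divM.
rewrite expnMn -{2}(subnK d0) addn1 expnS mulnCA mulnC [X in (_ < X)%N]mulnC.
by rewrite ltn_pmul2r // ltnW.
Qed.

(** Since [p <= 2 * (p - 1)], replacing [p - 1] by [p] costs a factor [2 ^ d]; then [p ^ k]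
    cancels. *)
Lemma cancel_exp_pred (p N d k : nat) : (1 < p)%N -> (k <= d)%N ->
  ((p - 1) ^ d <= N * d ^ d * (p ^ k * 2 ^ d))%N ->
  (p ^ (d - k) <= N * (4 * d) ^ d)%N.
Proof.
move=> p1 kd H; have pk0 : (0 < p ^ k)%N by rewrite expn_gt0 ltnW.
rewrite -(leq_pmul2r pk0) -expnD subnK //.
apply: (@leq_trans ((2 * (p - 1)) ^ d)); first by apply: leq_expl; lia.
rewrite expnMn; apply: (leq_trans (leq_mul (leqnn _) H)).
by rewrite -[4%N]/(2 * 2)%N !expnMn; apply: eq_leq; ring.
Qed.

(** The size bound is raised to the power [d - 1] to stay within natural numbers. *)
Lemma evasive_grid (d k : nat) : (0 < k)%N -> (k <= d)%N -> (2 <= d)%N ->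
  exists2 K, (0 < K)%N & forall n, (0 < n)%N ->
    exists V : {set {ffun 'I_d -> 'I_n.+1}},
    [/\ forall v i, v \in V -> (0 < v i)%N,
        (n ^ (d * (d - k)) <= K * #|V| ^ (d - 1))%N
      & forall V' : {set {ffun 'I_d -> 'I_n.+1}}, V' \subset V ->
          vanishing_minors k V' -> (#|V'| <= d ^ d)%N].
Proof.
move=> k0 kd d2.
have [K K0 KP] := exists_prime_near.
(* [K1] serves small [n], where one point suffices. [K2] combines
   [n ^ d <= 2 ^ d * (K * p) ^ (d - 1)] with [p ^ (d - k) <= #|V| * (4 * d) ^ d]. *)
pose K1 := ((2 ^ d * (K * d) ^ (d - 1)) ^ (d - k))%N.
pose K2 := ((2 ^ d * K ^ (d - 1)) ^ (d - k) * ((4 * d) ^ d) ^ (d - 1))%N.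
have dd0 : (0 < d ^ d)%N by rewrite expn_gt0; lia.
exists (maxn K1 K2) => [|n n0].
  by rewrite leq_max; apply/orP; left; rewrite /K1 !(expn_gt0, muln_gt0) K0; lia.
(* The largest such [X] has order [n ^ (d / (d - 1))], and the strict bound passes to every prime
   [p <= X]. *)
pose P X := (2 ^ d * X ^ (d - 1) < n ^ d)%N.
have P0 : exists X, P X by exists 0%N; rewrite /P exp0n ?muln0 ?expn_gt0 ?n0 //; lia.
have Pb X : P X -> (X <= n ^ d)%N.
  rewrite /P => PX; apply: ltnW; apply: leq_ltn_trans PX.
  rewrite -(subnSK d2); case: X => // X.
  by rewrite expnS mulnCA leq_pmulr // muln_gt0 !expn_gt0; lia.
case: (ex_maxnP P0 Pb) => X PX maxX.
have nX : (n ^ d <= 2 ^ d * X.+1 ^ (d - 1))%N.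
  by rewrite leqNgt; apply/negP => /maxX; rewrite ltnn.
(* [X >= K * d] forces [p > d], which keeps the interpolation nodes distinct modulo [p]. *)
rewrite expnM; have [Xs|Xb] := ltnP X (K * d).
  exists [set [ffun=> inord 1]]%SET; split.
  - by move=> v i; rewrite inE => /eqP ->; rewrite ffunE inordK.
  - rewrite cards1 exp1n muln1; apply: leq_trans (leq_maxl _ _).
    apply/leq_expl/(leq_trans nX); rewrite leq_mul2l; apply/orP; right.
    exact: leq_expl.
  - by move=> V' /subset_leq_card; rewrite cards1 => /leq_trans->.
have [|p pp /andP[pX Xp]] := KP X; first by have := leq_mul K0 d2; lia.
have dp : (d < p)%N by move: (leq_ltn_trans Xb Xp); rewrite ltn_mul2l => /andP[].
have hp : ((p %/ n).+1 ^ d < p)%N.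
  apply: divn_exp_ltn; rewrite ?prime_gt1 ?(ltnW d2) //.
  by apply: leq_ltn_trans PX; rewrite leq_mul2l leq_expl ?orbT.
have [V [V0 Vc VP]] := evasive_box pp k0 (ltnW dp) n0 hp.
exists V; split=> //.
apply: (@leq_trans (K2 * #|V| ^ (d - 1))); last by rewrite leq_mul2r leq_maxr orbT.
have pV := cancel_exp_pred (prime_gt1 pp) kd Vc.
apply: (@leq_trans ((2 ^ d * (K * p) ^ (d - 1)) ^ (d - k))).
  by apply/leq_expl/(leq_trans nX); rewrite leq_mul2l leq_expl ?orbT.
rewrite (expnMn K p) mulnA expnMn -(expnM p) (mulnC (d - 1)%N) expnM /K2 -mulnA.
rewrite leq_mul2l; apply/orP; right; apply: (leq_trans (leq_expl _ pV)).
by rewrite expnMn mulnC.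
Qed.

(** * The grid points in real space *)

Local Open Scope classical_set_scope.
Local Open Scope ring_scope.

Theorem theorem1p5 (R : realType) (k d : nat)
    (hk : (0 < k)%N) (hkd : (k <= d)%N) (hd : (2 <= d)%N) :
  exists (c : nat) (C : R),
    [/\ (0 < c)%N, 0 < C
      & forall n : nat, (0 < n)%N ->
        exists S : {fset 'rV[R]_d},
          [/\ [set` S] `<=` @grid R n d,
              C * n%:R `^ (d%:R * (d%:R - k%:R) / (d%:R - 1)) <= #|` S|%:R
            & forall U : {vspace 'rV[R]_d}, \dim U = k ->
                (#|` [fset x in S | x \in U]%fset| <= c)%N]].
Proof.
have [K K0 KP] := evasive_grid hk hkd hd.
exists (d ^ d)%N, (K%:R^-1); split.
- by rewrite expn_gt0; lia.
- by rewrite invr_gt0 ltr0n.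
move=> n n0; have [V [V0 Vc VP]] := KP n n0.
pose rw (v : {ffun 'I_d -> 'I_n.+1}) : 'rV[R]_d := \row_i (v i : nat)%:R.
have rw_inj : injective rw.
  move=> v w /rowP vw; apply/ffunP => i; have := vw i; rewrite !mxE => /eqP.
  by rewrite eqr_nat => /eqP/val_inj.
exists [fset rw v | v in V]%fset; split.
- move=> _ /= /imfsetP[v /= vV ->] i; exists (v i : nat); last by rewrite mxE.
  by rewrite (V0 v i vV) -ltnS ltn_ord.
- rewrite card_imfset //= -cardE.
  have d10 : (0 < d - 1)%N by lia.
  (* Raising to the power [d - 1] clears the denominator of the exponent. *)
  rewrite mulrC ler_pdivrMr ?ltr0n // -(ler_pXn2r d10) ?nnegrE ?powR_ge0
    ?mulr_ge0 ?ler0n //.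
  rewrite -powR_mulrn ?powR_ge0 // -powRrM.
  have -> : d%:R * (d%:R - k%:R) / (d%:R - 1) * (d - 1)%:R = (d * (d - k))%:R :> R.
    rewrite natrM !natrB ?divfK //; last lia.
    by rewrite subr_eq0 pnatr_eq1; lia.
  rewrite powR_mulrn // -natrX -natrM -natrX ler_nat; apply: (leq_trans Vc).
  rewrite expnMn mulnC leq_mul2l; apply/orP; right.
  by rewrite -(subnSK hd) expnS leq_pmulr // expn_gt0 K0.
- move=> U dU; pose V' := [set v in V | rw v \in U]%SET.
  have : (#|V'| <= d ^ d)%N.
    apply: VP; first by apply/fintype.subsetP => v; rewrite inE => /andP[].
    (* The minors vanish over the reals because the points lie in [U], hence over the integers,
       which embed in the reals. *)
    move=> r f g fV kr; apply/eqP; rewrite -(@intr_eq0 R) -det_map_mx.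
    rewrite -(minors_subspace (U := U) (f := fun i => rw (f i)) g) ?dU //; last first.
      by move=> i; have := fV i; rewrite inE => /andP[].
    by apply/eqP; congr (\det _); apply/matrixP => i j; rewrite !mxE.
  apply: leq_trans; apply: (@leq_trans #|` [fset rw v | v in V']%fset|); last first.
    by rewrite card_imfset //= -cardE.
  apply/fsubset_leq_card/fsubsetP => x; rewrite !inE /=.
  move=> /andP[/imfsetP[v /= vV ->] xU]; apply/imfsetP; exists v => //=.
  by rewrite inE vV.
Qed.
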